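(* Let $\xi\in\mathbb{C}$ with $\mathrm{Re}(\xi)>0$ and define $g_{\xi}\in A$ by $$g_{\xi}(a)=\exp\Big(-\pi\,{}^{\star}\varepsilon\,\xi\sum_{k\in L}a(k)^2\Big)\qquad(a\in X).$$ Then for every $b\in X$, $$(Fg_{\xi})(b)=C_{\xi}(b)\,g_{\xi}\!\left(\tfrac{b}{\xi}\right)=C_{\xi}(b)\exp\Big(-\pi\,{}^{\star}\varepsilon\,\tfrac{1}{\xi}\sum_{k\in L}b(k)^2\Big),$$ where $$C_{\xi}(b)=\sum_{a\in X}\varepsilon_0\exp\Big(-\pi\,{}^{\star}\varepsilon\,\xi\sum_{k\in L}\big(a(k)+i\tfrac{1}{\xi}b(k)\big)^2\Big).$$
   Context: Double nonstandard framework: $F_2$ is a nonprincipal ultrafilter on an infinite set $\Lambda_2$ and ${}^{*}S=S^{\Lambda_2}/F_2$ for a set $S$ (with $S\subset {}^*S$ via the diagonal embedding). $F_1$ is a nonprincipal ultrafilter on an infinite set $\Lambda_1$; for a ${}^*$-internal set $S$, ${}^{\star}S$ is the ${}^*$-ultrapower of $S$ with respect to ${}^*F_1$, so ${}^{\star}({}^{*}S)=S^{\Lambda_1\times\Lambda_2}/F_1^{F_2}$; ${}^{\star}x$ (or $\star(x)$) denotes the image of $x$ under this embedding, and $\star$-images of ${}^*$-objects are often identified with the objects themselves. ''Internal with a double meaning'' means internal for this double ultrapower. Let $H\in{}^{*}\mathbb{Z}$ be a positive even infinite number and $H'\in{}^{\star}({}^{*}\mathbb{Z})$ a positive even number larger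 than every element of ${}^{*}\mathbb{Z}$; $\varepsilon=1/H$, $\varepsilon'=1/H'$. Let $L=\{\varepsilon z: z\in{}^*\mathbb{Z},\,-H/2\le\varepsilon z<H/2\}$ (a ${}^*$-finite set of size $H^2$, identified with $\varepsilon\,{}^*\mathbb{Z}$ modulo $H$), and (this setting) $L'=\{\varepsilon' z': z'\in{}^{\star}({}^{*}\mathbb{Z}),\,-{}^{\star}H\frac{H'}{2}\le \varepsilon' z'<{}^{\star}H\frac{H'}{2}\}$, identified with $\varepsilon'\,{}^{\star}({}^*\mathbb{Z})$ modulo ${}^{\star}H H'$. $X$ is the set of internal (double meaning) functions from ${}^{\star}L$ to $L'$, and $A$ the set of internal (double meaning) functions $X\to{}^{\star}({}^{*}\mathbb{C})$. Put $\varepsilon_0=({}^{\star}H)^{-({}^{\star}H)^2/2}H'^{-({}^{\star}H)^2}$ and, for $f\in A$, $(Ff)(b)=\sum_{a\in X}\varepsilon_0\exp\big(-2\pi i\,{}^{\star}\varepsilon\sum_{k\in L}a(k)b(k)\big)f(a)$. (The paper writes $F(\mathbf{e}^{\sharp}(g_\xi))$, where $\mathbf{e}^\sharp$ merely regards $g_\xi$ as a functional on functions with values modulo ${}^{\star}HH'$; the transform is given by the displayed formula.) $\xi$ is identified with ${}^{\star}({}^{*}\xi)$. *)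

(* Defs.v *)
From HB Require Import structures.
From mathcomp Require Import all_boot all_order all_algebra.
From mathcomp Require Import generic_quotient.
From mathcomp Require Import complex.
From mathcomp Require Import all_classical all_reals all_analysis.

Set Implicit Arguments.
Unset Strict Implicit.
Unset Printing Implicit Defensive.

Import Order.TTheory GRing.Theory Num.Theory.
Local Open Scope classical_set_scope.
Local Open Scope ring_scope.
Local Open Scope quotient_scope.

Structure ultrafilter (I : Type) := Ultrafilter {
  uf_sets :> set I -> Prop;
  uf_ultra : UltraFilter (uf_sets : set_system I) }.

#[export] Existing Instance uf_ultra.

Definition nonprincipal (I : Type) (F : ultrafilter I) :=
  forall i : I, ~ F [set i].

Lemma uf_setC (I : Type) (F : ultrafilter I) (A : set I) : ~ F A <-> F (~` A).
Proof.
split=> [nFA|FCA FA]; first by have [] := in_ultra_setVsetC A (uf_ultra F).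
by apply: (@filter_not_empty _ (uf_sets F)); rewrite -(setICr A); apply: filterI.
Qed.

Section UltraPower.
Context (I : Type) (F : ultrafilter I) (S : Type).

Definition aeq (x y : {classic (I -> S)}) : bool :=
  `[< F [set i | x i = y i] >].

Lemma aeq_refl : reflexive aeq.
Proof. by move=> x; apply/asboolP; apply: filterE. Qed.

Lemma aeq_sym : symmetric aeq.
Proof.
by move=> x y; apply/asboolP/asboolP; apply: filterS => i.
Qed.

Lemma aeq_trans : transitive aeq.
Proof.
move=> y x z /asboolP xy /asboolP yz; apply/asboolP.
by apply: filterS2 xy yz => i /= ->.
Qed.

Canonical aeq_equiv := EquivRel aeq aeq_refl aeq_sym aeq_trans.

Definition upow := {eq_quot aeq}.
HB.instance Definition _ : EqQuotient _ aeq upow := EqQuotient.on upow.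
HB.instance Definition _ := Choice.on upow.

Definition uclass (x : I -> S) : upow := \pi_upow (x : {classic (I -> S)}).
Definition urepr (x : upow) : I -> S := repr x.

Lemma ureprK x : uclass (urepr x) = x.
Proof. exact: reprK. Qed.

Lemma uclassP (x y : I -> S) : uclass x = uclass y <-> F [set i | x i = y i].
Proof.
split=> [/eqP|xy]; first by rewrite /uclass eqmodE => /asboolP.
by apply/eqP; rewrite /uclass eqmodE; apply/asboolP.
Qed.

Lemma urepr_class (x : I -> S) : F [set i | urepr (uclass x) i = x i].
Proof. by apply/uclassP; rewrite ureprK. Qed.

Definition ucst (s : S) : upow := uclass (fun=> s).

(* The internal set [B_i] determined by a family of sets. *)
Definition uset (B : I -> set S) : set upow :=
  [set x | F [set i | B i (urepr x i)]].

Definition internal_set (E : set upow) := exists B, E = uset B.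

Definition hyperfinite (E : set upow) :=
  exists2 B : I -> set S, (forall i, finite_set (B i)) & E = uset B.

Lemma usetE B x : uset B (uclass x) <-> F [set i | B i (x i)].
Proof.
have Fx := urepr_class x; rewrite /uset /=; split=> h.
  by apply: filterS2 Fx h => i /= ->.
by apply: filterS2 Fx h => i /= ->.
Qed.

Lemma uset_sub B B' : uset B `<=` uset B' <-> F [set i | B i `<=` B' i].
Proof.
split=> [BB'|h x]; last by rewrite /uset/=; apply: filterS2 h => i; exact.
apply: contrapT => /uf_setC nF.
have [i0 /= /existsNP[s0 _]] := filter_ex nF.
pose x i := @xget {classic S} s0 (B i `\` B' i).
have xP : F [set i | (B i `\` B' i) (x i)].
  apply: filterS nF => i /= nBB'.
  have [s sP] : exists s, (B i `\` B' i) s.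
    by apply/set0P/eqP; rewrite setD_eq0.
  exact: (xgetI (T := {classic S}) s0 sP).
have /BB'/usetE xB' : uset B (uclass x).
  by apply/usetE; apply: filterS xP => i [].
have /filter_ex[i [/= + [_]]] :
  F ([set i | B' i (x i)] `&` [set i | (B i `\` B' i) (x i)]) by exact: filterI.
exact.
Qed.

Lemma uset_inj B B' : uset B = uset B' -> F [set i | B i = B' i].
Proof.
move=> e; have /uset_sub h : uset B `<=` uset B' by rewrite e.
have /uset_sub h' : uset B' `<=` uset B by rewrite e.
by apply: filterS2 h h' => i /= *; apply/seteqP.
Qed.

End UltraPower.

Arguments uset {I} F {S} B _.

Section Transfer.
Context (I : Type) (F : ultrafilter I).

Definition umap S T (f : S -> T) (x : upow F S) : upow F T :=
  uclass F (fun i => f (urepr x i)).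

Definition umap2 S T U (f : S -> T -> U) (x : upow F S) (y : upow F T) :
    upow F U :=
  uclass F (fun i => f (urepr x i) (urepr y i)).

Definition urel S T (r : S -> T -> Prop) (x : upow F S) (y : upow F T) : Prop :=
  F [set i | r (urepr x i) (urepr y i)].

Definition ule d (T : porderType d) : upow F T -> upow F T -> Prop :=
  urel (fun s t : T => (s <= t)%O).

Definition ult d (T : porderType d) : upow F T -> upow F T -> Prop :=
  urel (fun s t : T => (s < t)%O).

(* An element [f_i] of the ultrapower of a function space acts on the
   ultrapower of the domain by [f_i][x_i] = [f_i(x_i)]. *)
Definition uapp S T : upow F (S -> T) -> upow F S -> upow F T :=
  umap2 (fun (f : S -> T) s => f s).

Definition internal_on S T (E : set (upow F S)) (phi : upow F S -> upow F T) :=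
  exists f : upow F (S -> T), forall x, E x -> phi x = uapp f x.

Lemma umapE S T (f : S -> T) x :
  umap f (uclass F x) = uclass F (fun i => f (x i)).
Proof.
by apply/uclassP; apply: filterS (urepr_class F x) => i /= ->.
Qed.

Lemma umap2E S T U (f : S -> T -> U) x y :
  umap2 f (uclass F x) (uclass F y) = uclass F (fun i => f (x i) (y i)).
Proof.
by apply/uclassP; apply: filterS2 (urepr_class F x) (urepr_class F y)
  => i /= -> ->.
Qed.

Lemma uappE S T (f : I -> S -> T) x :
  uapp (uclass F f) (uclass F x) = uclass F (fun i => f i (x i)).
Proof. exact: umap2E. Qed.

Lemma urelE S T (r : S -> T -> Prop) x y :
  urel r (uclass F x) (uclass F y) <-> F [set i | r (x i) (y i)].
Proof.
have Fx := urepr_class F x; have Fy := urepr_class F y.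
rewrite /urel; split=> h.
  by apply: filterS3 Fx Fy h => i /= -> ->.
by apply: filterS3 Fx Fy h => i /= -> ->.
Qed.

Lemma upow_ind S (P : upow F S -> Prop) : (forall x, P (uclass F x)) -> forall x, P x.
Proof. by move=> h x; rewrite -(ureprK x). Qed.

(* Internal functions are determined by their values. *)
Lemma uapp_inj S T : injective (@uapp S T).
Proof.
elim/upow_ind => f; elim/upow_ind => g e; apply/uclassP.
have /uset_sub : uset F (fun=> setT) `<=` uset F (fun i => [set s | f i s = g i s]).
  elim/upow_ind => x _; apply/usetE.
  by apply/(uclassP F (fun i => f i (x i)) (fun i => g i (x i))); rewrite -!uappE e.
by apply: filterS => i /= fg; apply/funext => s; exact: fg.
Qed.

Lemma uapp_eq_on S T (B : I -> set S) (f g : I -> S -> T) :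
  (forall x, uset F B x -> uapp (uclass F f) x = uapp (uclass F g) x) <->
  F [set i | forall s, B i s -> f i s = g i s].
Proof.
split=> [e|h]; last first.
  elim/upow_ind => x /usetE Bx; rewrite !uappE; apply/uclassP.
  by apply: filterS2 h Bx => i /= h; exact: h.
suff /uset_sub : uset F B `<=` uset F (fun i => [set s | f i s = g i s]) by [].
elim/upow_ind => x Bx; apply/usetE.
by apply/(uclassP F (fun i => f i (x i)) (fun i => g i (x i))); rewrite -!uappE e.
Qed.

End Transfer.

Section UltraPowerZmod.
Context (I : Type) (F : ultrafilter I) (V : zmodType).

Let add := umap2 (F := F) (@GRing.add V).
Let opp := umap (F := F) (@GRing.opp V).
Let zero := ucst F (0 : V).

Lemma uaddA : associative add.
Proof.
elim/upow_ind => x; elim/upow_ind => y; elim/upow_ind => z.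
by rewrite /add !umap2E; congr uclass; apply/funext => i; rewrite addrA.
Qed.

Lemma uaddC : commutative add.
Proof.
elim/upow_ind => x; elim/upow_ind => y.
by rewrite /add !umap2E; congr uclass; apply/funext => i; rewrite addrC.
Qed.

Lemma uadd0 : left_id zero add.
Proof.
elim/upow_ind => x.
by rewrite /add /zero /ucst umap2E; congr uclass; apply/funext => i; rewrite add0r.
Qed.

Lemma uaddN : left_inverse zero opp add.
Proof.
elim/upow_ind => x.
by rewrite /add /opp umapE umap2E; congr uclass; apply/funext => i; rewrite addNr.
Qed.

HB.instance Definition _ :=
  GRing.isZmodule.Build (upow F V) uaddA uaddC uadd0 uaddN.

End UltraPowerZmod.

Section UltraPowerRing.
Context (I : Type) (F : ultrafilter I) (A : comNzRingType).

Let mul := umap2 (F := F) (@GRing.mul A).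
Let one := ucst F (1 : A).

Lemma umulA : associative mul.
Proof.
elim/upow_ind => x; elim/upow_ind => y; elim/upow_ind => z.
by rewrite /mul !umap2E; congr uclass; apply/funext => i; rewrite mulrA.
Qed.

Lemma umulC : commutative mul.
Proof.
elim/upow_ind => x; elim/upow_ind => y.
by rewrite /mul !umap2E; congr uclass; apply/funext => i; rewrite mulrC.
Qed.

Lemma umul1 : left_id one mul.
Proof.
elim/upow_ind => x.
by rewrite /mul /one /ucst umap2E; congr uclass; apply/funext => i; rewrite mul1r.
Qed.

Lemma umulDl : left_distributive mul +%R.
Proof.
elim/upow_ind => x; elim/upow_ind => y; elim/upow_ind => z.
by rewrite /mul /GRing.add /= !umap2E; congr uclass; apply/funext => i;
  rewrite mulrDl.
Qed.

Lemma uone_neq0 : one != 0.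
Proof.
apply/eqP => e; have /filter_ex[i /= /eqP] : F [set i | 1 = 0 :> A].
  by apply/(uclassP F (fun=> 1) (fun=> 0)).
by rewrite (negPf (oner_neq0 A)).
Qed.

HB.instance Definition _ :=
  GRing.Zmodule_isComNzRing.Build (upow F A) umulA umulC umul1 umulDl uone_neq0.

End UltraPowerRing.

Section UltraPowerField.
Context (I : Type) (F : ultrafilter I) (K : fieldType).

Let inv := umap (F := F) (@GRing.inv K).

Lemma umulVf (x : upow F K) : x != 0 -> inv x * x = 1.
Proof.
elim/upow_ind: x => x /eqP x0; have /uf_setC nx0 : ~ F [set i | x i = 0].
  by move=> h; apply: x0; apply/uclassP.
rewrite /inv umapE /GRing.mul /= umap2E; apply/uclassP.
by apply: filterS nx0 => i /= /eqP; exact: mulVf.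
Qed.

Lemma uinv0 : inv 0 = 0.
Proof.
by rewrite /inv /GRing.zero /= /ucst umapE; congr uclass; apply/funext => i;
  rewrite invr0.
Qed.

HB.instance Definition _ :=
  GRing.ComNzRing_isField.Build (upow F K) umulVf uinv0.

End UltraPowerField.

Section OperationsOnRepresentatives.
Context (I : Type) (F : ultrafilter I).

Lemma uaddE (V : zmodType) (x y : I -> V) :
  uclass F x + uclass F y = uclass F (fun i => x i + y i).
Proof. exact: umap2E. Qed.

Lemma uoppE (V : zmodType) (x : I -> V) :
  - uclass F x = uclass F (fun i => - x i).
Proof. exact: umapE. Qed.

Lemma umulE (A : comNzRingType) (x y : I -> A) :
  uclass F x * uclass F y = uclass F (fun i => x i * y i).
Proof. exact: umap2E. Qed.

Lemma uinvE (K : fieldType) (x : I -> K) :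
  (uclass F x)^-1 = uclass F (fun i => (x i)^-1).
Proof. exact: umapE. Qed.

Lemma unatE (A : comNzRingType) n : n%:R = uclass F (fun=> n%:R : A).
Proof.
elim: n => // n IHn; rewrite -natr1 IHn uaddE; congr uclass.
by apply/funext => i; rewrite natr1.
Qed.

Lemma uexists S (Q : I -> set S) :
  (exists x, uset F Q x) <-> F [set i | exists s, Q i s].
Proof.
split=> [[x]|h]; first by apply: filterS => i Qi; exists (urepr x i).
have [i0 [s0 _]] := filter_ex h.
pose x i : S := @xget {classic S} s0 (Q i).
exists (uclass F x); apply/usetE; apply: filterS h => i [s Qs].
exact: (xgetI (T := {classic S}) s0 Qs).
Qed.

End OperationsOnRepresentatives.

Section HyperfiniteSum.
Context (I : Type) (F : ultrafilter I) (S : choiceType) (V : zmodType).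
Implicit Types (E : set (upow F S)) (phi : upow F S -> upow F V).

(* The sum over E = [B_i] of phi = [G_i] is [\sum_(s in B_i) G_i(s)]. *)
Definition is_usum E phi (v : upow F V) :=
  exists (B : I -> set S) (G : I -> S -> V),
    [/\ forall i, finite_set (B i), E = uset F B,
        forall x, E x -> phi x = uapp (uclass F G) x &
        v = uclass F (fun i => \sum_(s \in B i) G i s)].

(* 0 when E is not hyperfinite or phi is not internal on E. *)
Definition usum E phi : upow F V := xget 0 (is_usum E phi).

Lemma is_usum_unique E phi v w : is_usum E phi v -> is_usum E phi w -> v = w.
Proof.
move=> [B [G [_ EB phiG ->]]] [B' [G' [_ EB' phiG' ->]]].
have BB' : F [set i | B i = B' i] by apply: uset_inj; rewrite -EB.
have GG' : F [set i | forall s, B i s -> G i s = G' i s].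
  by apply/uapp_eq_on => x; rewrite -EB => Ex; rewrite -phiG// phiG'.
apply/uclassP; apply: filterS2 BB' GG' => i /= <- GG'.
by apply: eq_fsbigr => s /set_mem; exact: GG'.
Qed.

Lemma usumP E phi : hyperfinite E -> internal_on E phi ->
  is_usum E phi (usum E phi).
Proof.
move=> [B finB EB] [f]; elim/upow_ind: f => G phiG.
apply: xgetPex; exists (uclass F (fun i => \sum_(s \in B i) G i s)).
by exists B, G; split.
Qed.

End HyperfiniteSum.

Section UltrafilterProduct.
Context (I J : Type) (F : ultrafilter I) (G : ultrafilter J).

(* F^G, so that (S^I / F)^J / G = S^(I * J) / F^G. *)
Definition uf_prod_sets : set_system (I * J) :=
  [set U | G [set j | F [set i | U (i, j)]]].

Lemma uf_prod_setsE U : uf_prod_sets U = G [set j | F [set i | U (i, j)]].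
Proof. by []. Qed.

Lemma uf_prod_ultra : UltraFilter uf_prod_sets.
Proof.
have PF : ProperFilter uf_prod_sets.
  apply: Build_ProperFilter_ex.
    move=> U GU; have [j /= FU] := @filter_ex _ (uf_sets G) _ _ GU.
    have [i Uij] := filter_ex FU.
    by exists (i, j).
  split.
  - by rewrite uf_prod_setsE; apply: filterE => j; apply: filterE.
  - by move=> U V; rewrite !uf_prod_setsE; apply: filterS2 => j /=; apply: filterI.
  - move=> U V UV; rewrite !uf_prod_setsE; apply: filterS => j /=; apply: filterS => i; exact: UV.
split=> // K PK sub; apply/seteqP; split=> // U KU.
apply: contrapT; rewrite uf_prod_setsE => /uf_setC nU.
have /sub KCU : uf_prod_sets (~` U).
  by rewrite uf_prod_setsE; apply: filterS nU => j /= /uf_setC.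
by apply: (@filter_not_empty _ K); rewrite -(setICr U); apply: filterI.
Qed.

Definition uf_prod : ultrafilter (I * J) := Ultrafilter uf_prod_ultra.

Lemma uf_prodE U : uf_prod U = G [set j | F [set i | U (i, j)]].
Proof. by []. Qed.

Definition star S (x : upow G S) : upow uf_prod S :=
  uclass uf_prod (fun p => urepr x p.2).

(* The extension [B_j]_(i,j) of an internal set [B_j]_j. *)
Definition star_set S (E : set (upow G S)) : set (upow uf_prod S) :=
  [set x | exists2 B : J -> set S,
     E = uset G B & uset uf_prod (fun p => B p.2) x].

Lemma starE S (x : J -> S) : star (uclass G x) = uclass uf_prod (fun p => x p.2).
Proof.
apply/uclassP; rewrite uf_prodE.
have Gx := urepr_class G x.
apply: filterS Gx => j /= ->.
by apply: filterE.
Qed.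

Lemma star_setE S (B : J -> set S) :
  star_set (uset G B) = uset uf_prod (fun p => B p.2).
Proof.
apply/seteqP; split=> [x [B' /uset_inj BB'] |x ?]; last by exists B.
apply: (uset_sub uf_prod (fun p => B' p.2) (fun p => B p.2)).2.
by rewrite uf_prodE; apply: filterS BB' => j /= ->; apply: filterE => i.
Qed.

End UltrafilterProduct.

Arguments star_set {I J} F {G S} E _.

Definition cexp (R : realType) (z : R[i]) : R[i] :=
  let: Complex x y := z in Complex (expR x * cos y) (expR x * sin y).

Section Lattices.
Context (R : realType) (Lam1 Lam2 : Type).
Context (F1 : ultrafilter Lam1) (F2 : ultrafilter Lam2).

Let F12 := uf_prod F1 F2.

Definition uR_of_Z (I : Type) (F : ultrafilter I) : upow F int -> upow F R :=
  umap (fun z : int => z%:~R).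

Definition uC_of_R (I : Type) (F : ultrafilter I) : upow F R -> upow F R[i] :=
  umap (fun x : R => Complex x 0).

Definition ueven (I : Type) (F : ultrafilter I) (x : upow F int) :=
  exists y : upow F int, x = y *+ 2.

Context (H : upow F2 int) (H' : upow F12 int).

Let hR : upow F2 R := uR_of_Z H.
Let sHR : upow F12 R := star F1 hR.
Let h'R : upow F12 R := uR_of_Z H'.

Definition eps : upow F2 R := hR^-1.
Definition eps' : upow F12 R := h'R^-1.

Definition latL : set (upow F2 R) :=
  [set x | exists z : upow F2 int,
     [/\ x = eps * uR_of_Z z, ule (- (hR / 2)) x & ult x (hR / 2)]].

Definition latL' : set (upow F12 R) :=
  [set x | exists z : upow F12 int,
     [/\ x = eps' * uR_of_Z z, ule (- (sHR * (h'R / 2))) x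
       & ult x (sHR * (h'R / 2))]].

Definition sL : set (upow F12 R) := star_set F1 latL.

(* Internal functions from sL to latL', coded as the elements of the
   ultrapower of R -> R whose action maps sL to latL' and vanishes off sL;
   see [spX_onto] and [spX_inj] below. *)
Definition spX : set (upow F12 (R -> R)) :=
  [set a | (forall k, sL k -> latL' (uapp a k)) /\
           (forall k, ~ sL k -> uapp a k = 0)].

Definition lat (c l u : R) : set R :=
  [set x | exists z : int, [/\ x = c^-1 * z%:~R, l <= x & x < u]].

Lemma finite_lat c l u : finite_set (lat c l u).
Proof.
pose M := `|c| * (`|l| + `|u|).
pose f (p : bool * nat) : R := c^-1 * ((-1) ^+ p.1 * p.2%:R).
apply: (@sub_finite_set _ _ (f @` (setT `*` `I_(Num.truncn M).+1) `|` [set 0])).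
  move=> x [z [xE lx xu]]; have [c0|c0] := eqVneq c 0.
    by right; rewrite /= xE c0 invr0 mul0r.
  left; exists (z < 0, `|z|%N) => /=; last first.
    by rewrite xE /f/= [in RHS](intEsign z) rmorphM rmorphXn/= rmorphN1.
  split=> //=; rewrite ltnS truncn_ge_nat; last first.
    by rewrite mulr_ge0// addr_ge0.
  have -> : `|z|%N%:R = `|c| * `|x|.
    by rewrite -normrM xE mulVKf// -intr_norm natr_absz.
  apply: ler_wpM2l => //; have [x0|x0] := leP 0 x.
    rewrite ger0_norm// (le_trans (ltW xu))// (le_trans (ler_norm u))//.
    by rewrite lerDr.
  rewrite ltr0_norm// (le_trans (_ : - x <= - l)) ?lerN2//.
  by rewrite (le_trans (ler_norm _))// normrN lerDl.
by rewrite finite_setU; split=> //; apply: finite_image; apply: finite_setX.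
Qed.

Lemma uset_lat I (F : ultrafilter I) (c l u : I -> R) :
  [set x | exists z : upow F int,
     [/\ x = (uclass F c)^-1 * uR_of_Z z, ule (uclass F l) x & ult x (uclass F u)]]
  = uset F (fun i => lat (c i) (l i) (u i)).
Proof.
apply/seteqP; split; elim/upow_ind => x.
  move=> [z]; elim/upow_ind: z => z [].
  rewrite /uR_of_Z umapE uinvE umulE => /uclassP xz /urelE lx /urelE xu.
  by apply/usetE; apply: filterS3 xz lx xu => i /= *; exists (z i); split.
move=> /usetE /uexists[z]; elim/upow_ind: z => z /usetE h.
exists (uclass F z); split; rewrite /uR_of_Z.
- rewrite umapE uinvE umulE; apply/uclassP.
  by apply: filterS h => i [].
- by apply/urelE; apply: filterS h => i [].
- by apply/urelE; apply: filterS h => i [].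
Qed.

Let h i : R := (urepr H i)%:~R.
Let h' p : R := (urepr H' p)%:~R.
Definition famL i := lat (h i) (- (h i / 2)) (h i / 2).
Definition famL' p := lat (h' p) (- (h p.2 * (h' p / 2))) (h p.2 * (h' p / 2)).

Lemma latL_uset : latL = uset F2 famL.
Proof.
by rewrite -uset_lat /latL /eps /hR /uR_of_Z /umap unatE !uinvE !umulE uoppE.
Qed.

Lemma latL'_uset : latL' = uset F12 famL'.
Proof.
have e2 : h'R / 2 = uclass F12 (fun p => h' p / 2).
  by rewrite unatE uinvE [LHS]umulE.
have e : sHR * (h'R / 2) = uclass F12 (fun p => h p.2 * (h' p / 2)).
  by rewrite e2 /sHR starE [LHS]umulE.
by rewrite -uset_lat /latL' e uoppE.
Qed.

Lemma sL_uset : sL = uset F12 (fun p => famL p.2).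
Proof. by rewrite /sL latL_uset star_setE. Qed.

Definition famX p : set (R -> R) :=
  [set a | (forall k, famL p.2 k -> famL' p (a k)) /\
           (forall k, ~ famL p.2 k -> a k = 0)].

Lemma spX_uset : spX = uset F12 famX.
Proof.
apply/seteqP; split; elim/upow_ind => a.
  move=> [aL a0]; apply/usetE.
  have /uset_sub h1 : uset F12 (fun p => famL p.2)
      `<=` uset F12 (fun p => [set k | famL' p (a p k)]).
    elim/upow_ind => k; rewrite -sL_uset => /aL.
    by rewrite uappE latL'_uset => /usetE ?; apply/usetE.
  have /uset_sub h2 : uset F12 (fun p => ~` famL p.2)
      `<=` uset F12 (fun p => [set k | a p k = 0]).
    elim/upow_ind => k /usetE /uf_setC kL; have : ~ sL (uclass F12 k).
      by rewrite sL_uset => /usetE.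
    by move=> /a0; rewrite uappE => /uclassP ?; apply/usetE.
  by apply: filterS2 h1 h2 => p /= h1 h2; split.
move=> /usetE ha; split; elim/upow_ind => k.
  rewrite sL_uset latL'_uset => /usetE kL; rewrite uappE; apply/usetE.
  by apply: filterS2 ha kL => p /= [ha _] /ha.
rewrite sL_uset => kL; have {}kL : F12 [set p | ~ famL p.2 (k p)].
  by apply/uf_setC => ?; apply: kL; apply/usetE.
rewrite uappE; apply/uclassP.
by apply: filterS2 ha kL => p /= [_ ha] /ha.
Qed.

Lemma finite_funs (s t : seq R) :
  finite_set [set a : R -> R | (forall k, k \in s -> a k \in t) /\
                               (forall k, k \notin s -> a k = 0)].
Proof.
elim: s => [|k0 s IHs].
  apply: (@sub_finite_set _ _ [set (fun=> 0)]) => // a [_ a0].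
  by apply/funext => k; exact: a0.
pose f (p : R * (R -> R)) : R -> R := fun k => if k == k0 then p.1 else p.2 k.
have := finite_image f (finite_setX (finite_seq t) IHs).
apply: sub_finite_set => a [at_ a0].
exists (a k0, fun k => if k \in s then a k else 0) => /=; last first.
  apply/funext => k; rewrite /f/=; case: eqVneq => [->//|kk0].
  by case: ifPn => // ks; rewrite a0// inE negb_or kk0.
split=> /=; first by rewrite at_// mem_head.
by split=> k; [move=> ks; rewrite ks at_// inE ks orbT|move/negPf->].
Qed.

Lemma spX_hyperfinite : hyperfinite spX.
Proof.
exists famX; last exact: spX_uset.
move=> p; have [s sE] := (finite_seqP _).1
  (finite_lat (h p.2) (- (h p.2 / 2)) (h p.2 / 2)).
have [t tE] := (finite_seqP _).1 (finite_lat (h' p)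
  (- (h p.2 * (h' p / 2))) (h p.2 * (h' p / 2))).
apply: sub_finite_set (finite_funs s t) => a; rewrite /famX /famL /famL' sE tE/=.
by move=> [aL a0]; split=> // k /negP; exact: a0.
Qed.

Lemma sL_hyperfinite : hyperfinite sL.
Proof.
exists (fun p => famL p.2); [move=> p; exact: finite_lat|exact: sL_uset].
Qed.

Lemma spX_onto (f : upow F12 R -> upow F12 R) :
  internal_on sL f -> (forall k, sL k -> latL' (f k)) ->
  exists2 a, spX a & forall k, sL k -> uapp a k = f k.
Proof.
move=> [g]; elim/upow_ind: g => g fg fL.
pose a p k := if `[< famL p.2 k >] then g p k else 0.
have ag k : sL k -> uapp (uclass F12 a) k = f k.
  move=> kL; rewrite fg//; move: k kL; rewrite sL_uset; apply/uapp_eq_on.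
  by apply: filterE => p k kL; rewrite /a asboolT.
exists (uclass F12 a) => //; split=> [k kL|]; first by rewrite ag//; exact: fL.
elim/upow_ind => k kL; have {}kL : F12 [set p | ~ famL p.2 (k p)].
  by apply/uf_setC => ?; apply: kL; rewrite sL_uset; apply/usetE.
by rewrite uappE; apply/uclassP; apply: filterS kL => p /= ?; rewrite /a asboolF.
Qed.

Lemma spX_inj a b : spX a -> spX b ->
  (forall k, sL k -> uapp a k = uapp b k) -> a = b.
Proof.
move=> [_ a0] [_ b0] ab; apply: uapp_inj; apply/funext => k.
by have [/ab//|kL] := pselect (sL k); rewrite a0// b0.
Qed.

Definition spA : set (upow F12 (R -> R) -> upow F12 R[i]) :=
  [set f | internal_on spX f].

Definition eps0 : upow F12 R :=
  umap2 (@powR R) sHR (- (sHR ^+ 2 / 2)) * umap2 (@powR R) h'R (- sHR ^+ 2).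

Definition uexp : upow F12 R[i] -> upow F12 R[i] := umap (@cexp R).
Definition upi : upow F12 R[i] := uC_of_R (ucst F12 (pi : R)).
Definition ui : upow F12 R[i] := ucst F12 (Complex 0 1).
Definition seps : upow F12 R[i] := uC_of_R (star F1 eps).

Definition valC (a : upow F12 (R -> R)) (k : upow F12 R) : upow F12 R[i] :=
  uC_of_R (uapp a k).

Definition Fourier (f : upow F12 (R -> R) -> upow F12 R[i])
    (b : upow F12 (R -> R)) : upow F12 R[i] :=
  usum spX (fun a =>
    uC_of_R eps0
    * uexp (- 2 * upi * ui * seps * usum sL (fun k => valC a k * valC b k))
    * f a).

(* The formula defining g_xi, for complex-valued c, so that g_xi(b / xi)
   makes sense although b / xi is not an element of spX. *)
Definition gaussC (xi : R[i]) (c : upow F12 R -> upow F12 R[i]) : upow F12 R[i] :=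
  uexp (- upi * seps * ucst F12 xi * usum sL (fun k => c k ^+ 2)).

Definition gauss (xi : R[i]) (a : upow F12 (R -> R)) : upow F12 R[i] :=
  gaussC xi (valC a).

Definition Cxi (xi : R[i]) (b : upow F12 (R -> R)) : upow F12 R[i] :=
  usum spX (fun a =>
    uC_of_R eps0
    * uexp (- upi * seps * ucst F12 xi *
        usum sL (fun k => (valC a k + ui * (ucst F12 xi)^-1 * valC b k) ^+ 2))).

End Lattices.

(* Main.v *)
Require Import Defs.
From HB Require Import structures.
From mathcomp Require Import all_boot all_order all_algebra.
From mathcomp Require Import complex ring.
From mathcomp Require Import all_classical all_reals all_analysis.

Set Implicit Arguments.
Unset Strict Implicit.
Unset Printing Implicit Defensive.

Import Order.TTheory GRing.Theory Num.Theory.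
Local Open Scope classical_set_scope.
Local Open Scope ring_scope.

(* Completing the square, xi a^2 + 2 i a b = xi (a + i b / xi)^2 + b^2 / xi,
   under the hyperfinite sums: the last term does not depend on a, so its
   exponential factors out of the sum over X. This is legitimate because every
   summand is an internal function of a. *)

(** * Linearity of hyperfinite sums *)

Section HyperfiniteSumTheory.
Context (I : Type) (F : ultrafilter I) (S : choiceType).

Lemma usum_uclass (V : zmodType) (B : I -> set S) (G : I -> S -> V)
    (phi : upow F S -> upow F V) :
  (forall i, finite_set (B i)) ->
  (forall x, phi (uclass F x) = uclass F (fun i => G i (x i))) ->
  usum (uset F B) phi = uclass F (fun i => \sum_(s \in B i) G i s).
Proof.
move=> finB phiG.
have phiE x : uset F B x -> phi x = uapp (uclass F G) x.
  by elim/upow_ind: x => x _; rewrite phiG uappE.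
apply: is_usum_unique (usumP _ _) _.
- by exists B.
- by exists (uclass F G).
- by exists B, G; split.
Qed.

(** [is_usum] looks at its function only on [E], so both sides have the same admissible values and
    [xget] makes the same choice, default 0 included. *)
Lemma eq_usum (V : zmodType) (E : set (upow F S)) (phi psi : upow F S -> upow F V) :
  (forall x, E x -> phi x = psi x) -> usum E phi = usum E psi.
Proof.
move=> e; rewrite /usum; congr (xget 0 _); apply/seteqP.
by split=> v [B [G [? ? h ?]]]; exists B, G; split=> // x Ex; rewrite -h// e.
Qed.

Lemma usumD (V : zmodType) (E : set (upow F S)) (phi psi : upow F S -> upow F V) :
  hyperfinite E -> internal_on E phi -> internal_on E psi ->
  usum E (fun x => phi x + psi x) = usum E phi + usum E psi.
Proof.
move=> [B finB ->] [f phif] [g psig]; elim/upow_ind: f phif => f phif.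
elim/upow_ind: g psig => g psig.
(* [phi] and [psi] are known only on the set, whereas [usum_uclass] wants a formula on all classes;
   the actions of [f] and [g] supply it. *)
rewrite (eq_usum phif) (eq_usum psig).
rewrite (eq_usum (psi := fun x => uapp (uclass F f) x + uapp (uclass F g) x));
  last by move=> x Ex; rewrite phif// psig.
rewrite (usum_uclass finB (uappE F f)) (usum_uclass finB (uappE F g)) uaddE.
rewrite (usum_uclass (G := fun i s => f i s + g i s) finB); last first.
  by move=> x; rewrite !uappE uaddE.
by congr uclass; apply/funext => i; rewrite fsbig_split.
Qed.

(** The component [c i] varies with [i] but not with [s], so ordinary distributivity applies in each
    component. *)
Lemma usumMl (A : comNzRingType) (E : set (upow F S)) (c : upow F A)
    (phi : upow F S -> upow F A) :
  hyperfinite E -> internal_on E phi ->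
  usum E (fun x => c * phi x) = c * usum E phi.
Proof.
move=> [B finB ->] [f phif]; elim/upow_ind: f phif => f phif.
elim/upow_ind: c => c.
rewrite (eq_usum phif).
rewrite (eq_usum (psi := fun x => uclass F c * uapp (uclass F f) x));
  last by move=> x Ex; rewrite phif.
rewrite (usum_uclass finB (uappE F f)) umulE.
rewrite (usum_uclass (G := fun i s => c i * f i s) finB); last first.
  by move=> x; rewrite !uappE umulE.
congr uclass; apply/funext => i.
by rewrite !fsbig_finite//= mulr_sumr.
Qed.

End HyperfiniteSumTheory.

(** * Closure properties of internal functions *)

Section InternalFunctions.
Context (I : Type) (F : ultrafilter I) (S : Type).
Implicit Types E : set (upow F S).

Lemma internal_cst E T (c : upow F T) : internal_on E (fun=> c).
Proof.
elim/upow_ind: c => c; exists (uclass F (fun i _ => c i)).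
by elim/upow_ind => x _; rewrite uappE.
Qed.

Lemma internal_uapp E T (f : upow F (S -> T)) : internal_on E (uapp f).
Proof. by exists f. Qed.

Lemma internal_umap E T U (g : T -> U) (phi : upow F S -> upow F T) :
  internal_on E phi -> internal_on E (fun x => umap g (phi x)).
Proof.
move=> [f]; elim/upow_ind: f => f phif.
exists (uclass F (fun i s => g (f i s))).
by elim/upow_ind => x /phif ->; rewrite !uappE umapE.
Qed.

Lemma internal_umap2 E T U W (g : T -> U -> W)
    (phi : upow F S -> upow F T) (psi : upow F S -> upow F U) :
  internal_on E phi -> internal_on E psi ->
  internal_on E (fun x => umap2 g (phi x) (psi x)).
Proof.
move=> [f]; elim/upow_ind: f => f phif [k]; elim/upow_ind: k => k psik.
exists (uclass F (fun i s => g (f i s) (k i s))).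
by elim/upow_ind => x Ex; rewrite phif// psik// !uappE umap2E.
Qed.

Lemma internal_add E (V : zmodType) (phi psi : upow F S -> upow F V) :
  internal_on E phi -> internal_on E psi ->
  internal_on E (fun x => phi x + psi x).
Proof. exact: internal_umap2. Qed.

Lemma internal_mul E (A : comNzRingType) (phi psi : upow F S -> upow F A) :
  internal_on E phi -> internal_on E psi ->
  internal_on E (fun x => phi x * psi x).
Proof. exact: internal_umap2. Qed.

(** Sums over [sL] occur inside the summands of sums over [spX], so they must be internal in their
    parameter; the componentwise finite sums serve as code. *)
Lemma internal_usum (T : choiceType) (V : zmodType) E (D : set (upow F T))
    (G : I -> S -> T -> V) (phi : upow F S -> upow F T -> upow F V) :
  hyperfinite D ->
  (forall a x, phi (uclass F a) (uclass F x)
     = uclass F (fun i => G i (a i) (x i))) ->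
  internal_on E (fun a => usum D (phi a)).
Proof.
move=> [B finB ->] phiG.
exists (uclass F (fun i a => \sum_(s \in B i) G i a s)).
elim/upow_ind => a _; rewrite uappE.
by rewrite (usum_uclass (G := fun i => G i (a i)) finB).
Qed.

End InternalFunctions.

(** * The exponential law, the Gaussian and its transform *)

Lemma cexpD (R : realType) (z w : R[i]) : cexp (z + w) = cexp z * cexp w.
Proof.
case: z => x y; case: w => u v; rewrite /cexp /=; simpc.
by rewrite expRD cosD sinD; congr Complex; ring.
Qed.

Section Gaussian.
Context (R : realType) (Lam1 Lam2 : Type).
Context (F1 : ultrafilter Lam1) (F2 : ultrafilter Lam2).
Let F := uf_prod F1 F2.
Context (H : upow F2 int) (H' : upow F int).
Implicit Types (a b : upow F (R -> R)) (xi : R[i]).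

Lemma uexpD (z w : upow F R[i]) : uexp (z + w) = uexp z * uexp w.
Proof.
elim/upow_ind: z => z; elim/upow_ind: w => w.
rewrite /uexp uaddE !umapE umulE; congr uclass.
by apply/funext => p; rewrite cexpD.
Qed.

Lemma internal_valC (E : set (upow F R)) a : internal_on E (valC a).
Proof. by apply: internal_umap; exact: internal_uapp. Qed.

Lemma valC_uclass (A : Lam1 * Lam2 -> R -> R) (k : Lam1 * Lam2 -> R) :
  valC (uclass F A) (uclass F k) = uclass F (fun p => Complex (A p (k p)) 0).
Proof. by rewrite /valC uappE /uC_of_R umapE. Qed.

Lemma gauss_internal xi : spA H H' (gauss H xi).
Proof.
apply: internal_umap; apply: internal_mul; first exact: internal_cst.
apply: (internal_usum _ (phi := fun a k => valC a k ^+ 2)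
  (G := fun _ (a : R -> R) k => Complex (a k) 0 ^+ 2)).
  exact: sL_hyperfinite.
by move=> a x; rewrite valC_uclass !expr2 umulE.
Qed.

(** Meets the internality condition of [usumMl] for the sum [Cxi]. The fixed [b] and [e] enter
    through their components, hence the dependence of [G] on [p]. *)
Lemma Cxi_summand_internal (E : set (upow F (R -> R))) (c d e : upow F R[i]) b :
  internal_on E (fun a =>
    c * uexp (d * usum (sL H) (fun k => (valC a k + e * valC b k) ^+ 2))).
Proof.
apply: internal_mul; first exact: internal_cst.
apply: internal_umap; apply: internal_mul; first exact: internal_cst.
elim/upow_ind: b => b; elim/upow_ind: e => e.
apply: (internal_usum _
  (phi := fun a k => (valC a k + uclass F e * valC (uclass F b) k) ^+ 2)
  (G := fun p (a : R -> R) k => (Complex (a k) 0 + e p * Complex (b p k) 0) ^+ 2)).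
  exact: sL_hyperfinite.
by move=> a x; rewrite !valC_uclass umulE uaddE !expr2 umulE.
Qed.

(** Used with [e = i / xi]: the cross term then yields the Fourier kernel and the last term a
    Gaussian exponent in [b]. *)
Lemma usum_valC_sqr (e : upow F R[i]) a b :
  usum (sL H) (fun k => (valC a k + e * valC b k) ^+ 2) =
  usum (sL H) (fun k => valC a k ^+ 2)
  + (2 * e) * usum (sL H) (fun k => valC a k * valC b k)
  + e ^+ 2 * usum (sL H) (fun k => valC b k ^+ 2).
Proof.
have Lfin := sL_hyperfinite R F1 H.
have intM (u v : upow F (R -> R)) : internal_on (sL H) (fun k => valC u k * valC v k).
  by apply: internal_mul; exact: internal_valC.
have intZ c (u v : upow F (R -> R)) : internal_on (sL H) (fun k => c * (valC u k * valC v k)).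
  by apply: internal_mul => //; exact: internal_cst.
transitivity (usum (sL H) (fun k => valC a k * valC a k
    + (2 * e) * (valC a k * valC b k) + e ^+ 2 * (valC b k * valC b k))).
  by apply: eq_usum => k _; ring.
by rewrite !usumD ?usumMl//; apply: internal_add.
Qed.

Lemma ui_sqr : ui R F1 F2 ^+ 2 = -1.
Proof.
have -> : -1 = uclass F (fun=> -1 : R[i]) by exact: (uoppE F (fun=> 1 : R[i])).
by rewrite expr2 /ui umulE; congr uclass; apply/funext => p; simpc.
Qed.

(** Otherwise the set of indices where the constant family vanishes would be in the ultrafilter,
    hence inhabited. This gives [field] its side condition in the ultrapower. *)
Lemma ucst_neq0 xi : xi != 0 -> ucst F xi != 0.
Proof.
move=> /eqP xi0; apply/eqP => /uclassP h.
by have [p] := filter_ex h.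
Qed.

Lemma Fourier_gauss xi b : xi != 0 ->
  Fourier H H' (gauss H xi) b
  = Cxi H H' xi b *
    uexp (- upi R F1 F2 * seps R F1 H * (ucst F xi)^-1 *
          usum (sL H) (fun k => valC b k ^+ 2)).
Proof.
(* The Gaussian in [b] is moved inside [Cxi], so that the two sums over [spX] can be compared term
   by term. *)
move=> /ucst_neq0 xi0; rewrite [RHS]mulrC /Cxi -usumMl; last 2 first.
- exact: spX_hyperfinite.
- exact: Cxi_summand_internal.
apply: eq_usum => a _; rewrite /gauss /gaussC -mulrA -uexpD [RHS]mulrCA -uexpD.
(* For [e = i / xi], [xi * e ^+ 2 = - xi^-1] cancels the exponent of the Gaussian in [b], and
   [xi * (2 * e) = 2 * i] leaves the kernel. *)
congr (_ * uexp _); rewrite usum_valC_sqr exprMn ui_sqr.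
by field.
Qed.

(** By homogeneity the division contributes [xi^-1 ^+ 2], which the coefficient [xi] reduces to
    [xi^-1]. *)
Lemma gaussC_div xi b : xi != 0 ->
  gaussC H xi (fun k => valC b k / ucst F xi)
  = uexp (- upi R F1 F2 * seps R F1 H * (ucst F xi)^-1 *
          usum (sL H) (fun k => valC b k ^+ 2)).
Proof.
move=> /ucst_neq0 xi0; rewrite /gaussC.
rewrite (eq_usum (psi := fun k => (ucst F xi)^-1 ^+ 2 * (valC b k ^+ 2)));
  last by move=> k _; rewrite exprMn mulrC.
rewrite usumMl; last 2 first.
- exact: sL_hyperfinite.
- by apply: internal_mul; exact: internal_valC.
by congr uexp; field.
Qed.

End Gaussian.

Theorem theorem3p1 (R : realType) (Lam1 Lam2 : Type)
  (infinite_Lam1 : infinite_set [set: Lam1])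
  (infinite_Lam2 : infinite_set [set: Lam2])
  (F1 : ultrafilter Lam1) (F2 : ultrafilter Lam2)
  (nonprincipal_F1 : nonprincipal F1) (nonprincipal_F2 : nonprincipal F2)
  (H : upow F2 int)
  (H_gt0 : ult 0 H) (H_even : ueven H)
  (H_infinite : forall z : int, ult (ucst F2 z) H)
  (H' : upow (uf_prod F1 F2) int)
  (H'_gt0 : ult 0 H') (H'_even : ueven H')
  (H'_infinite : forall z : upow F2 int, ult (star F1 z) H')
  (xi : R[i]) (Re_xi_gt0 : 0 < complex.Re xi) :
  spA H H' (gauss H xi) /\
  forall b : upow (uf_prod F1 F2) (R -> R), spX H H' b ->
    Fourier H H' (gauss H xi) b
      = Cxi H H' xi b * gaussC H xi (fun k => valC b k / ucst _ xi)
    /\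
    Fourier H H' (gauss H xi) b
      = Cxi H H' xi b *
        uexp (- upi R F1 F2 * seps R F1 H * (ucst _ xi)^-1 *
              usum (sL H) (fun k => valC b k ^+ 2)).
Proof.
have xi0 : xi != 0 by apply: contraTneq Re_xi_gt0 => ->; rewrite ltxx.
split; first exact: gauss_internal.
(* After [gaussC_div] both equalities have the same right-hand side. *)
by move=> b _; rewrite gaussC_div//; split; exact: Fourier_gauss.
Qed.
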